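(* For all positive integers $\rho,\ell$ with $\rho\ge\ell$, there exist matroids with rank $\rho$ and girth $\ell+1$ whose correlation gap is arbitrarily close to $1-\frac{e^{-\ell}\ell^\ell}{\ell!}$; that is, for every $\varepsilon>0$ there is a matroid with rank function $r$, rank $\rho$ and girth $\ell+1$ such that $$\left|\mathcal{CG}(r)-\left(1-\frac{e^{-\ell}\ell^\ell}{\ell!}\right)\right|\le\varepsilon.$$
   Context: Matroids are on a finite ground set. The girth of a matroid is the smallest size of a dependent set. The correlation gap of a matroid means the correlation gap $\mathcal{CG}(r)$ of its rank function $r$. For $f\colon 2^E\to\mathbb{R}_+$ and $x\in[0,1]^E$, the multilinear extension is $F(x)=\sum_{S\subseteq E}f(S)\prod_{i\in S}x_i\prod_{i\notin S}(1-x_i)$, and the concave extension is $\hat f(x)=\max\{\sum_{S\subseteq E}\lambda_S f(S): \sum_{S\ni i}\lambda_S=x_i\ \forall i\in E,\ \sum_{S\subseteq E}\lambda_S=1,\ \lambda\ge0\}$. The correlation gap of $f$ is $\mathcal{CG}(f)=\inf_{x\in[0,1]^E}F(x)/\hat f(x)$, with the convention $0/0=1$. *)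

(* Defs.v *)
From mathcomp Require Import all_boot all_order all_algebra.
From mathcomp Require Import all_classical all_reals all_analysis.
Set Implicit Arguments.
Unset Strict Implicit.
Unset Printing Implicit Defensive.

Import Order.TTheory GRing.Theory Num.Theory.
Local Open Scope ring_scope.

Record matroid (E : finType) := Matroid {
  indep : pred {set E};
  indep_empty : indep finset.set0;
  indep_sub : forall I J : {set E}, I \subset J -> indep J -> indep I;
  indep_aug : forall I J : {set E}, indep I -> indep J -> (#|I| < #|J|)%N ->
    exists2 e, e \in (J :\: I)%SET & indep (e |: I)%SET
}.

Definition mrank (E : finType) (M : matroid E) (A : {set E}) : nat :=
  \max_(I : {set E} | indep M I && (I \subset A)) #|I|.

Definition matroid_rank (E : finType) (M : matroid E) : nat :=
  mrank M [set: E]%SET.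

(* Stated as a predicate because a matroid without dependent sets
   has no (finite) girth. *)
Definition has_girth (E : finType) (M : matroid E) (g : nat) : Prop :=
  (exists2 D : {set E}, ~~ indep M D & #|D| = g) /\
  (forall D : {set E}, ~~ indep M D -> (g <= #|D|)%N).

Definition unit_cube (R : realType) (E : finType) : set (E -> R) :=
  [set x | forall i, 0 <= x i <= 1]%classic.

Definition multilinear_ext (R : realType) (E : finType) (f : {set E} -> R)
    (x : E -> R) : R :=
  \sum_(S : {set E})
    f S * (\prod_(i | i \in S) x i) * \prod_(i | i \notin S) (1 - x i).

(* lambda is a probability distribution on the subsets of E
   whose marginals are x. *)
Definition marginal_distr (R : realType) (E : finType) (x : E -> R)
    (lambda : {set E} -> R) : Prop :=
  [/\ forall i, \sum_(S : {set E} | i \in S) lambda S = x i,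
      \sum_(S : {set E}) lambda S = 1
    & forall S, 0 <= lambda S].

(* For x in the unit cube, the feasible set is a nonempty compact polytope and
   the objective is linear, so this supremum is a maximum. *)
Definition concave_ext (R : realType) (E : finType) (f : {set E} -> R)
    (x : E -> R) : R :=
  sup [set \sum_(S : {set E}) lambda S * f S | lambda in marginal_distr x]%classic.

(* Division with the convention 0 / 0 = 1 (in the library, 0 / 0 = 0). *)
Definition ratio01 (R : realType) (a b : R) : R :=
  if (a == 0) && (b == 0) then 1 else a / b.

Definition correlation_gap (R : realType) (E : finType) (f : {set E} -> R) : R :=
  inf [set ratio01 (multilinear_ext f x) (concave_ext f x)
      | x in @unit_cube R E]%classic.

Definition matroid_correlation_gap (R : realType) (E : finType)
    (M : matroid E) : R :=
  correlation_gap (fun A : {set E} => (mrank M A)%:R : R).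

(* Main.v *)
Require Import Defs.
From mathcomp Require Import all_boot all_order all_algebra.
From mathcomp Require Import all_classical all_reals all_analysis.
From mathcomp Require Import zify ring lra.
Set Implicit Arguments.
Unset Strict Implicit.
Unset Printing Implicit Defensive.

Import Order.TTheory GRing.Theory Num.Theory.
Import numFieldNormedType.Exports.
Local Open Scope ring_scope.

(** The matroid is the direct sum of the uniform matroid of rank [l] on [m * l]
elements and of the free matroid on [rho - l] further elements, with [m] large.

Write [N] for the uniform part.  The rank of [S] is
[l - (l - #|S :&: N|)^+ + #|S :\: N|], so for independent inclusions with
probabilities [x] everything reduces to the shortfall, the expectation of
[(l - X)^+] where [X] is a sum of independent Bernoulli variables of total mean
[mu].  Let [h_l(t)] be the same expectation for a Poisson variable of mean [t]
([pois_shortfall]).  Since [h_l' = - Q_l] with [Q_l = h_l - h_(l-1)] the Poisson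
distribution function at [l - 1], revealing one Bernoulli variable of mean [p]
turns [h_l(t)] into [h_l(t) + p h_l'(t)], the value at [t + p] of a tangent to
the graph of [h_l].  As [h_l] is convex and its derivative is 1-Lipschitz,
[h_l(t + p)] exceeds this value by at most [p^2].  Induction on the number
of variables gives [bernoulli_shortfall_bounds]:
[h_l(mu) - \sum x_i^2 <= shortfall <= h_l(mu)].

The upper bound on the shortfall gives the lower bound on the gap at every [x]:
by convexity [h_l] lies below its chord on [[0, l]], it decreases after [l], and
[h_l(0) = l], [h_l(l) = l c] with [c = e^-l l^l / l!]; hence the expected rank
is at least [1 - c] times [min(mu, l) + \sum_(i \notin N) x_i], which bounds the
concave extension ([gap_uniform_plus_free_ge]).  The lower bound on the
shortfall gives the upper bound on the gap: at [x = 1 / m] on [N] and [0]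
elsewhere, the concave extension is at least [l], as seen by splitting [N] into
[m] blocks of size [l] and picking one at random, while the expected rank is at
most [l (1 - c) + l / m] ([gap_block_le]). *)

(** * The Poisson shortfall *)

Definition pois_pmf {R : realType} (k : nat) (t : R) : R :=
  expR (- t) * (t ^+ k / k`!%:R).

(** The probability that a Poisson variable of mean [t] is less than [l]. *)
Definition pois_cdf {R : realType} (l : nat) (t : R) : R :=
  \sum_(k < l) pois_pmf k t.

(** The expectation of [(l - X)^+] for a Poisson variable [X] of mean [t], as
the sum of the probabilities that [X <= j] over [j < l]; in this form its
derivative is a telescoping sum. *)
Definition pois_shortfall {R : realType} (l : nat) (t : R) : R :=
  \sum_(j < l) pois_cdf j.+1 t.

Section Poisson.
Context {R : realType}.
Implicit Types (k l : nat) (t a b : R).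

Lemma pois_cdfS l t : pois_cdf l.+1 t = pois_cdf l t + pois_pmf l t.
Proof. by rewrite /pois_cdf big_ord_recr. Qed.

Lemma pois_shortfallS l t : pois_shortfall l.+1 t = pois_shortfall l t + pois_cdf l.+1 t.
Proof. by rewrite /pois_shortfall big_ord_recr. Qed.

(** At [l = 0] both sides vanish, so the predecessor needs no side condition. *)
Lemma pois_shortfall_pred l t :
  pois_shortfall l t - pois_shortfall l.-1 t = pois_cdf l t.
Proof.
case: l => [|l]; last by rewrite pois_shortfallS addrC addKr.
by rewrite subrr /pois_cdf big_ord0.
Qed.

Lemma mul_pois_pmf k t : t * pois_pmf k t = k.+1%:R * pois_pmf k.+1 t.
Proof.
rewrite /pois_pmf factS natrM exprS; field.
by rewrite ?nat1r ?natr1 !pnatr_eq0 -lt0n fact_gt0.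
Qed.

Lemma pois_pmf_ge0 k t : 0 <= t -> 0 <= pois_pmf k t.
Proof. by move=> t0; rewrite !(mulr_ge0, expR_ge0, invr_ge0, exprn_ge0). Qed.

Lemma pois_pmf_le1 k t : 0 <= t -> pois_pmf k t <= 1.
Proof.
move=> t0; rewrite /pois_pmf expRN mulrC ler_pdivrMr ?expR_gt0// mul1r.
case: k => [|k]; first by rewrite expr0 fact0 divr1 -expR0 ler_expR.
by apply: le_trans (expR_ge1Dxn k t0); rewrite lerDr.
Qed.

Lemma pois_cdf_ge0 l t : 0 <= t -> 0 <= pois_cdf l t.
Proof. by move=> t0; apply: sumr_ge0 => k _; exact: pois_pmf_ge0. Qed.

Lemma is_derive_pois_pmf k t : is_derive t 1 (@pois_pmf R k)
  ((if k is k'.+1 then pois_pmf k' t else 0) - pois_pmf k t).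
Proof.
have Ek : @pois_pmf R k = (expR \o -%R) * (k`!%:R^-1 \*: (id ^+ k)).
  apply/funext => x; rewrite /pois_pmf /= fctE /=.
  by rewrite [RHS]/GRing.mul /= [_ *: _]mulrC fctE.
rewrite [X in is_derive _ _ X]Ek.
apply: is_derive_eq => /=.
rewrite /pois_pmf fctE /= /GRing.scale /=.
case: k {Ek} => [|k]; first by rewrite fact0 /=; ring.
rewrite factS natrM exprS; field.
by rewrite ?nat1r ?natr1 !pnatr_eq0 -lt0n fact_gt0.
Qed.

Lemma is_derive_pois_cdf l t :
  is_derive t 1 (@pois_cdf R l.+1) (- pois_pmf l t).
Proof.
elim: l => [|l IH].
  have -> : @pois_cdf R 1 = pois_pmf 0.
    by apply/funext => x; rewrite /pois_cdf big_ord1.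
  by have := is_derive_pois_pmf 0 t; rewrite sub0r.
have -> : @pois_cdf R l.+2 = pois_cdf l.+1 + pois_pmf l.+1.
  by apply/funext => x; rewrite pois_cdfS.
have h := is_derive_pois_pmf l.+1 t.
by apply: is_derive_eq => /=; ring.
Qed.

Lemma is_derive_pois_shortfall l t :
  is_derive t 1 (@pois_shortfall R l) (- pois_cdf l t).
Proof.
have -> : @pois_shortfall R l = \sum_(j < l) pois_cdf j.+1.
  by apply/funext => x; rewrite fct_sumE.
have -> : - pois_cdf l t = \sum_(k < l) - pois_pmf k t by rewrite sumrN.
by apply: is_derive_sum => j; exact: is_derive_pois_cdf.
Qed.

Lemma MVT_is_derive (f df : R -> R) a b :
  (forall t, is_derive t 1 f (df t)) -> a <= b ->
  exists2 c, a <= c <= b & f b - f a = df c * (b - a).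
Proof.
move=> fdf ab.
have cf : {within `[a, b], continuous f}%classic.
  by apply: derivable_within_continuous => x _; have [] := fdf x.
have [c] := MVT_segment ab (fun x _ => fdf x) cf.
by rewrite in_itv /=; exists c.
Qed.

(** For [l > 0] the derivative is [- pois_pmf (l - 1)], which lies between [-1] and
[0] on the nonnegative half-line. *)
Lemma pois_cdf_lipschitz l a b : 0 <= a -> a <= b ->
  pois_cdf l b <= pois_cdf l a <= pois_cdf l b + (b - a).
Proof.
move=> a0 ab; case: l => [|l].
  by rewrite /pois_cdf !big_ord0 lexx add0r subr_ge0.
have [c /andP[ac cb] e] := MVT_is_derive (is_derive_pois_cdf l) ab.
have c0 : 0 <= c by lra.
have := pois_pmf_ge0 l c0; have := pois_pmf_le1 l c0.
set p := pois_pmf l c in e * => p1 p0; nra.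
Qed.

(** Convexity of [pois_shortfall l]: its derivative [- pois_cdf l] is nondecreasing. *)
Lemma pois_shortfall_tangent l a b : 0 <= a -> 0 <= b ->
  pois_shortfall l a - pois_cdf l a * (b - a) <= pois_shortfall l b.
Proof.
move=> a0 b0; have [ab|/ltW ba] := leP a b.
  have [c /andP[ac cb] e] := MVT_is_derive (is_derive_pois_shortfall l) ab.
  have /andP[+ _] := pois_cdf_lipschitz l a0 ac; nra.
have [c /andP[bc ca] e] := MVT_is_derive (is_derive_pois_shortfall l) ba.
have /andP[+ _] := pois_cdf_lipschitz l (le_trans b0 bc) ca; nra.
Qed.

(** The middle term is the value at [t + p] of the tangent at [t].  It is at most
[pois_shortfall l (t + p)] by convexity; the tangent at [t + p] and the Lipschitz
bound on the slope control the difference. *)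
Lemma pois_shortfall_step l t p : 0 <= t -> 0 <= p ->
  pois_shortfall l (t + p) - p ^+ 2 <=
    (1 - p) * pois_shortfall l t + p * pois_shortfall l.-1 t <= pois_shortfall l (t + p).
Proof.
move=> t0 p0.
have -> : (1 - p) * pois_shortfall l t + p * pois_shortfall l.-1 t
          = pois_shortfall l t - p * pois_cdf l t.
  by rewrite -pois_shortfall_pred; ring.
have tp0 : 0 <= t + p by lra.
have := pois_shortfall_tangent l t0 tp0; have := pois_shortfall_tangent l tp0 t0.
have ttp : t <= t + p by lra.
have /andP[] := pois_cdf_lipschitz l t0 ttp.
move=> h1 h2 h3 h4; nra.
Qed.

Lemma pois_shortfall0 l : pois_shortfall l 0 = l%:R :> R.
Proof.
rewrite /pois_shortfall (eq_bigr (fun=> 1)) ?sumr_const ?card_ord// => j _.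
rewrite /pois_cdf big_ord_recl big1 ?addr0 => [|k _]; last first.
  by rewrite /pois_pmf expr0n /= !(mul0r, mulr0).
by rewrite /pois_pmf oppr0 expR0 fact0 divr1 mulr1.
Qed.

Lemma pois_shortfallE l t :
  pois_shortfall l t = (l%:R - t) * pois_cdf l t + l%:R * pois_pmf l t.
Proof.
elim: l => [|l IH]; first by rewrite /pois_shortfall /pois_cdf !big_ord0; ring.
rewrite pois_shortfallS IH -mul_pois_pmf pois_cdfS -natr1; ring.
Qed.

(** For [t <= l] this is the chord between [(0, l)] and
[(l, l * pois_pmf l l)]; for [t >= l] it is monotonicity.  Both follow from the
tangent at [t], evaluated at [0] and at [l]. *)
Lemma pois_shortfall_le_chord l t : (0 < l)%N -> 0 <= t ->
  pois_shortfall l t <= l%:R - (1 - pois_pmf l l%:R) * Num.min t l%:R.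
Proof.
move=> l0 t0; have l0' : 0 < l%:R :> R by rewrite ltr0n.
have hl : pois_shortfall l l%:R = l%:R * pois_pmf l l%:R :> R.
  by rewrite pois_shortfallE subrr mul0r add0r.
have := pois_shortfall_tangent l t0 (lexx 0); rewrite pois_shortfall0 => h0.
have := pois_shortfall_tangent l t0 (ltW l0'); rewrite hl => h1.
have := pois_cdf_ge0 l t0.
set q := pois_cdf _ _ in h0 h1 *; set h := pois_shortfall _ _ in h0 h1 *.
set c := pois_pmf _ _ in h1 *; set L := l%:R in l0' h0 h1 *.
move=> q0; have [tl|lt] := leP t L; last by nra.
rewrite -(ler_pM2l l0'); nra.
Qed.

End Poisson.

(** * Independent inclusion of the elements *)

Section Bernoulli.
Context {R : realType} {E : finType}.
Implicit Types (S T A N : {set E}) (x : E -> R) (e : E).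

Definition bernoulli_weight x (S : {set E}) : R :=
  (\prod_(i | i \in S) x i) * \prod_(i | i \notin S) (1 - x i).

Lemma multilinear_extE (f : {set E} -> R) x :
  multilinear_ext f x = \sum_S bernoulli_weight x S * f S.
Proof.
by apply: eq_bigr => S _; rewrite /bernoulli_weight -mulrA mulrC.
Qed.

Lemma sum_bernoulli_weight x : \sum_S bernoulli_weight x S = 1.
Proof.
have <- : \prod_i (x i + (1 - x i)) = 1 by apply: big1 => i _; rewrite subrKC.
rewrite bigA_distr; apply: eq_bigr => S _.
rewrite [RHS](bigID (mem S)) /=; congr (_ * _); apply: eq_bigr => i.
  by move=> ->.
by move=> /negbTE ->.
Qed.

Lemma bernoulli_weight_ge0 x S : unit_cube x -> 0 <= bernoulli_weight x S.
Proof.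
move=> hx; rewrite mulr_ge0// prodr_ge0// => i _; have /andP[] := hx i.
  by [].
by rewrite subr_ge0.
Qed.

(** Independence: if [f] ignores whether [e] is present, then conditioning on the
presence of [e] does not change the expectation of [f]. *)
Lemma bernoulli_weight_mem x e (f : {set E} -> R) :
  (forall S : {set E}, f (e |: S)%SET = f S) ->
  \sum_(S : {set E} | e \in S) bernoulli_weight x S * f S
    = x e * \sum_S bernoulli_weight x S * f S.
Proof.
move=> fe.
(* For S avoiding e: its probability as a set of elements other than e. *)
pose v (S : {set E}) :=
  (\prod_(i | i \in S) x i) * \prod_(i | (i \notin S) && (i != e)) (1 - x i).
set a := \sum_(S : {set E} | e \notin S) v S * f S.
have Ein : \sum_(S : {set E} | e \in S) bernoulli_weight x S * f S = x e * a.
  rewrite (reindex_onto (fun S : {set E} => e |: S)%SET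
                        (fun S : {set E} => S :\ e)%SET) /=; last first.
    by move=> S eS; rewrite finset.setD1K.
  rewrite mulr_sumr; apply: eq_big => S.
    rewrite setU11 /=; apply/eqP/idP => [<-|eS]; first by rewrite !inE eqxx.
    by rewrite setU1K.
  move=> /andP[_ /eqP eS]; have {}eS : e \notin S by rewrite -eS !inE eqxx.
  rewrite fe mulrA; congr (_ * _).
  rewrite /bernoulli_weight /v big_setU1 //= -mulrA; congr (_ * (_ * _)).
  by apply: eq_bigl => i; rewrite !inE negb_or andbC.
have Eout :
    \sum_(S : {set E} | e \notin S) bernoulli_weight x S * f S = (1 - x e) * a.
  rewrite mulr_sumr; apply: eq_bigr => S eS; rewrite mulrA; congr (_ * _).
  rewrite /bernoulli_weight /v [in LHS](bigD1 (P := fun i => i \notin S) e) //=.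
  by rewrite mulrCA.
rewrite [in RHS](bigID (fun S : {set E} => e \in S)) /= Ein Eout; ring.
Qed.

Lemma bernoulli_weight_marginal x : unit_cube x ->
  marginal_distr x (bernoulli_weight x).
Proof.
move=> hx.
split=> [i||S]; [|exact: sum_bernoulli_weight|exact: bernoulli_weight_ge0].
have := @bernoulli_weight_mem x i (fun=> 1) (fun=> erefl).
under eq_bigr do rewrite mulr1.
under [in RHS]eq_bigr do rewrite mulr1.
by rewrite sum_bernoulli_weight mulr1.
Qed.

Lemma marginal_distr_card x lambda A : marginal_distr x lambda ->
  \sum_S lambda S * #|(S :&: A)%SET|%:R = \sum_(i in A) x i.
Proof.
move=> [hx _ _]; under [RHS]eq_bigr do rewrite -hx.
rewrite (exchange_big_dep xpredT) //=; apply: eq_bigr => S _.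
rewrite sumr_const mulr_natr; congr (_ *+ _).
by apply: eq_card => i; rewrite !inE andbC.
Qed.

(** Conditioning on [e]: if it is present, one slot of the [l] is filled. *)
Lemma bernoulli_shortfall_step x T e l : e \notin T ->
  let F T l := \sum_S bernoulli_weight x S * (l - #|(S :&: T)%SET|)%:R in
  F (e |: T)%SET l = (1 - x e) * F T l + x e * F T l.-1.
Proof.
move=> eT F.
have inv k S :
    (k - #|((e |: S) :&: T)%SET|)%:R = (k - #|(S :&: T)%SET|)%:R :> R.
  rewrite (_ : ((e |: S) :&: T = S :&: T)%SET) //; apply/finset.setP => i.
  by rewrite !inE; case: eqVneq => [->|//]; rewrite (negbTE eT) !andbF.
have h1 := bernoulli_weight_mem x (inv l.-1).
have h2 := bernoulli_weight_mem x (inv l).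
pose g S : R := bernoulli_weight x S * (l - #|(S :&: T)%SET|)%:R.
have h3 : F T l = \sum_(S : {set E} | e \in S) g S
                  + \sum_(S : {set E} | e \notin S) g S.
  by rewrite [LHS](bigID (fun S : {set E} => e \in S)).
rewrite mulrBl mul1r -h2 {1}h3 -h1 [X in X + _]addrAC subrr add0r addrC.
rewrite [LHS](bigID (fun S : {set E} => e \in S)) /=.
congr (_ + _); apply: eq_bigr => S eS.
  congr (_ * _%:R); rewrite -subn1 -subnDA; congr (_ - _)%N.
  rewrite (_ : (S :&: (e |: T) = e |: (S :&: T))%SET).
    by rewrite cardsU1 inE (negbTE eT) andbF.
  by apply/finset.setP => i; rewrite !inE; case: eqVneq => [->|//]; rewrite eS.
rewrite (_ : (S :&: (e |: T) = S :&: T)%SET) //; apply/finset.setP => i.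
by rewrite !inE; case: eqVneq => [->|//]; rewrite (negbTE eS).
Qed.

(** Each element of [T] contributes one [bernoulli_shortfall_step], to be compared
with one [pois_shortfall_step]; the errors [x i ^+ 2] add up. *)
Lemma bernoulli_shortfall_bounds x T l : unit_cube x ->
  pois_shortfall l (\sum_(i in T) x i) - \sum_(i in T) x i ^+ 2
    <= \sum_S bernoulli_weight x S * (l - #|(S :&: T)%SET|)%:R
    <= pois_shortfall l (\sum_(i in T) x i).
Proof.
move=> hx; have [n] := ubnP #|T|; elim: n T l => // n IH T l.
have [->|[e eT]] := set_0Vmem T.
  move=> _; rewrite !big_set0 pois_shortfall0 subr0.
  under eq_bigr do rewrite finset.setI0 cards0 subn0.
  by rewrite -mulr_suml sum_bernoulli_weight mul1r lexx.
rewrite -(finset.setD1K eT); set T' := (T :\ e)%SET.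
have eT' : e \notin T' by rewrite !inE eqxx.
rewrite cardsU1 eT' add1n ltnS => cT'.
rewrite bernoulli_shortfall_step // !big_setU1 //=.
have /andP[lo hi] := IH T' l cT'; have /andP[lo' hi'] := IH T' l.-1 cT'.
have /andP[p0 p1] := hx e.
have s0 : 0 <= \sum_(i in T') x i.
  by apply: sumr_ge0 => i _; have /andP[] := hx i.
have /andP[] := pois_shortfall_step l s0 p0.
rewrite [x e + \sum_(i in T') x i]addrC.
set h := pois_shortfall l (_ + _); set A := \sum_S _; set B := \sum_S _.
set q := \sum_(i in T') x i ^+ 2.
move: lo hi lo' hi'; rewrite -/A -/B -/q => *; apply/andP; split; nra.
Qed.

End Bernoulli.

(** * Direct sum of a uniform and a free matroid *)

Section UniformPlusFree.
Context {E : finType} (N : {set E}) (l : nat).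
Implicit Types (A I J D : {set E}).

Let indepN : pred {set E} := fun I => (#|(I :&: N)%SET| <= l)%N.

Fact indepN_empty : indepN finset.set0.
Proof. by rewrite /indepN finset.set0I cards0. Qed.

Fact indepN_sub I J : I \subset J -> indepN J -> indepN I.
Proof. by move=> IJ; apply: leq_trans; apply/subset_leq_card/finset.setSI. Qed.

Fact indepN_aug I J : indepN I -> indepN J -> (#|I| < #|J|)%N ->
  exists2 e, e \in (J :\: I)%SET & indepN (e |: I)%SET.
Proof.
rewrite /indepN => Il Jl IJ.
have grow e : (#|((e |: I) :&: N)%SET| <= (e \in N) + #|(I :&: N)%SET|)%N.
  case: (boolP (e \in N)) => eN.
    rewrite (_ : ((e |: I) :&: N = e |: (I :&: N))%SET).
      by rewrite cardsU1 leq_add2r leq_b1.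
    by apply/finset.setP => i; rewrite !inE; case: eqVneq => [->|]; rewrite ?eN.
  rewrite (_ : ((e |: I) :&: N = I :&: N)%SET) //.
  apply/finset.setP => i; rewrite !inE; case: eqVneq => [->|//].
  by rewrite (negbTE eN) !andbF.
have [JI|/fintype.subsetPn[e]] := boolP (J :\: N \subset I :\: N)%SET; last first.
  rewrite !inE => /andP[eN eJ]; rewrite eN /= => eI.
  exists e; first by rewrite !inE eI.
  by apply: leq_trans (grow e) _; rewrite (negbTE eN).
have IJN : (#|(I :&: N)%SET| < #|(J :&: N)%SET|)%N.
  move: IJ; rewrite -(cardsID N I) -(cardsID N J).
  by have := subset_leq_card JI; lia.
have /fintype.subsetPn[e] : ~~ (J :&: N \subset I :&: N)%SET.
  by apply: contraTN IJN => /subset_leq_card; rewrite -leqNgt.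
rewrite !inE => /andP[eJ eN]; rewrite eN andbT => eI.
exists e; first by rewrite !inE eI.
by apply: leq_trans (grow e) _; rewrite eN; lia.
Qed.

Definition uniform_plus_free : matroid E :=
  Matroid indepN_empty indepN_sub indepN_aug.

Lemma mrank_uniform_plus_free A :
  mrank uniform_plus_free A = (minn #|(A :&: N)%SET| l + #|(A :\: N)%SET|)%N.
Proof.
apply/eqP; rewrite eqn_leq; apply/andP; split.
  apply/bigmax_leqP => I /andP[/= Il IA].
  rewrite -(cardsID N I) leq_add ?leq_min ?[X in _ && X]Il ?andbT //.
    by apply/subset_leq_card/finset.setSI.
  by apply/subset_leq_card/finset.setSD.
have [s [us ss sA]] := card_geqP (geq_minl #|(A :&: N)%SET| l).
pose B := [set i in s]%SET.
have BA : B \subset (A :&: N)%SET.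
  by apply/fintype.subsetP => i; rewrite inE; exact: sA.
have cB : #|B| = minn #|(A :&: N)%SET| l.
  by rewrite -ss -(card_uniqP us); apply: eq_card => i; rewrite inE.
have EB : ((B :|: (A :\: N)) :&: N = B)%SET.
  apply/finset.setP => i; have := fintype.subsetP BA i; rewrite !inE.
  by case: (i \in s) => [/(_ isT)/andP[_ ->]//|_]; case: (i \in N); rewrite ?andbF.
have EA : ((B :|: (A :\: N)) :\: N = A :\: N)%SET.
  apply/finset.setP => i; have := fintype.subsetP BA i; rewrite !inE.
  by case: (i \in s) => [/(_ isT)/andP[_ ->]//|_]; case: (i \in N).
have <- : #|(B :|: (A :\: N))%SET|
          = (minn #|(A :&: N)%SET| l + #|(A :\: N)%SET|)%N.
  by rewrite -(cardsID N) EB EA cB.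
apply: (leq_bigmax_cond (F := fun I => #|I|)) => /=.
rewrite /indepN EB cB geq_minr /= finset.subUset finset.subsetDl andbT.
by apply: fintype.subset_trans BA (finset.subsetIl _ _).
Qed.

Lemma has_girth_uniform_plus_free : (l < #|N|)%N ->
  has_girth uniform_plus_free l.+1.
Proof.
move=> lN; split=> [|D]; rewrite /= /indepN.
  have [s [us ss sN]] := card_geqP lN.
  have cs : #|[set i in s]%SET| = l.+1.
    by rewrite -ss -(card_uniqP us); apply: eq_card => i; rewrite inE.
  exists [set i in s]%SET => //; rewrite /indepN.
  rewrite (finset.setIidPl _) ?cs ?ltnn //.
  by apply/fintype.subsetP => i; rewrite inE; exact: sN.
by rewrite -ltnNge => /leq_trans; apply; apply/subset_leq_card/finset.subsetIl.
Qed.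

End UniformPlusFree.

(** * Bounding a correlation gap from both sides *)

Section CorrelationGap.
Context {R : realType} {E : finType}.
Implicit Types (f lambda : {set E} -> R) (x : E -> R) (c : R).

Lemma has_ubound_marginal f x : (forall S, 0 <= f S) ->
  has_ubound [set \sum_(S : {set E}) lambda S * f S
             | lambda in marginal_distr x]%classic.
Proof.
move=> f0; exists (\sum_S f S) => _ [lambda [_ s1 l0] <-].
apply: ler_sum => S _; rewrite -[leRHS]mul1r ler_wpM2r// -s1.
by rewrite (bigD1 S) //= lerDl sumr_ge0.
Qed.

Lemma multilinear_ext_ge0 f x : (forall S, 0 <= f S) -> unit_cube x ->
  0 <= multilinear_ext f x.
Proof.
move=> f0 hx; rewrite multilinear_extE sumr_ge0// => S _.
by rewrite mulr_ge0// bernoulli_weight_ge0.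
Qed.

Lemma multilinear_ext_le_concave_ext f x : (forall S, 0 <= f S) ->
  unit_cube x -> multilinear_ext f x <= concave_ext f x.
Proof.
move=> f0 hx; apply: (ub_le_sup (has_ubound_marginal x f0)).
exists (bernoulli_weight x); first exact: bernoulli_weight_marginal.
by rewrite multilinear_extE.
Qed.

(** Points where the concave extension vanishes need care: there the multilinear
extension vanishes as well, because independent inclusion is one of the
competing distributions, and the ratio is [1] by convention. *)
Lemma correlation_gap_ge f c : (forall S, 0 <= f S) -> 0 <= c <= 1 ->
  (forall x lambda, unit_cube x -> marginal_distr x lambda ->
     c * \sum_S lambda S * f S <= multilinear_ext f x) ->
  c <= correlation_gap f.
Proof.
move=> f0 /andP[c0 c1] H; apply: lb_le_inf.
  exists (ratio01 (multilinear_ext f (fun=> 0)) (concave_ext f (fun=> 0))).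
  by exists (fun=> 0) => // i; rewrite lexx ler01.
move=> _ [x hx <-]; rewrite /ratio01.
have F0 := multilinear_ext_ge0 f0 hx.
have FC := multilinear_ext_le_concave_ext f0 hx.
case: ifPn => // /nandP FCn0.
have C0 : 0 < concave_ext f x.
  rewrite lt_def (le_trans F0 FC) andbT; apply/negP => /eqP C0.
  by case: FCn0 => /negP[]; rewrite ?C0 // eq_le F0 andbT -C0.
rewrite ler_pdivlMr//.
have [->|cn0] := eqVneq c 0; first by rewrite mul0r.
have {cn0} c0' : 0 < c by rewrite lt_def cn0.
rewrite mulrC -ler_pdivlMr//; apply: ge_sup.
  exists (\sum_S bernoulli_weight x S * f S), (bernoulli_weight x) => //.
  exact: bernoulli_weight_marginal.
by move=> _ [lambda hl <-]; rewrite ler_pdivlMr// mulrC; exact: H.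
Qed.

Lemma correlation_gap_le f x lambda : (forall S, 0 <= f S) ->
  unit_cube x -> marginal_distr x lambda -> 0 < \sum_S lambda S * f S ->
  correlation_gap f <= multilinear_ext f x / \sum_S lambda S * f S.
Proof.
move=> f0 hx hl s0.
have sC : \sum_S lambda S * f S <= concave_ext f x.
  by apply: (ub_le_sup (has_ubound_marginal x f0)); exists lambda.
have C0 := lt_le_trans s0 sC.
apply: le_trans (_ : multilinear_ext f x / concave_ext f x <= _); last first.
  by rewrite ler_wpM2l ?multilinear_ext_ge0// lef_pV2 ?posrE.
apply: ge_inf.
  exists 0 => _ [y hy <-]; rewrite /ratio01; case: ifP => // _.
  have F0 := multilinear_ext_ge0 f0 hy.
  by rewrite divr_ge0// (le_trans F0)// multilinear_ext_le_concave_ext.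
by exists x => //; rewrite /ratio01 (gt_eqF C0) andbF.
Qed.

End CorrelationGap.

(** * Lower bound for a uniform plus a free matroid *)

Section GapUniformPlusFree.
Context {R : realType} {E : finType} (N : {set E}) (l : nat).
Implicit Types (A : {set E}) (x : E -> R) (lambda : {set E} -> R).

Let r A : R := (mrank (uniform_plus_free N l) A)%:R.

Lemma rank_shortfallE A :
  r A = l%:R - (l - #|(A :&: N)%SET|)%:R + #|(A :&: ~: N)%SET|%:R.
Proof.
rewrite /r mrank_uniform_plus_free natrD -finset.setDE -natrB ?leq_subr//.
by congr (_%:R + _); lia.
Qed.

Lemma sum_rank_shortfallE x lambda : marginal_distr x lambda ->
  \sum_S lambda S * r S = l%:R
    - \sum_S lambda S * (l - #|(S :&: N)%SET|)%:R + \sum_(i in ~: N) x i.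
Proof.
move=> hl; rewrite -(marginal_distr_card _ hl); case: hl => _ s1 _.
under eq_bigr do rewrite rank_shortfallE mulrDr mulrBr.
by rewrite big_split sumrB /= -mulr_suml s1 mul1r.
Qed.

(** A bound on the concave extension that no longer depends on the distribution. *)
Lemma sum_rank_le x lambda : marginal_distr x lambda ->
  \sum_S lambda S * r S
    <= Num.min (\sum_(i in N) x i) l%:R + \sum_(i in ~: N) x i.
Proof.
move=> hl; rewrite (sum_rank_shortfallE hl) lerD2r le_min; apply/andP; split.
  rewrite -(marginal_distr_card N hl); case: hl => _ s1 l0.
  rewrite lerBlDr (_ : l%:R = \sum_S lambda S * l%:R) -?big_split /=; last first.
    by rewrite -mulr_suml s1 mul1r.
  apply: ler_sum => S _; rewrite -mulrDr ler_wpM2l// -natrD ler_nat; lia.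
by rewrite gerBl sumr_ge0// => S _; case: hl => _ _ l0; rewrite mulr_ge0.
Qed.

Lemma gap_uniform_plus_free_ge : (0 < l)%N ->
  1 - pois_pmf l l%:R <= matroid_correlation_gap R (uniform_plus_free N l).
Proof.
move=> l_gt0.
have p0 := pois_pmf_ge0 l (ler0n R l); have p1 := pois_pmf_le1 l (ler0n R l).
apply: correlation_gap_ge => [S||x lambda hx hl]; rewrite ?ler0n//.
  by rewrite subr_ge0 p1 gerBl.
rewrite multilinear_extE (sum_rank_shortfallE (bernoulli_weight_marginal hx)).
have sN : 0 <= \sum_(i in N) x i.
  by apply: sumr_ge0 => i _; have /andP[] := hx i.
have sF : 0 <= \sum_(i in ~: N) x i.
  by apply: sumr_ge0 => i _; have /andP[] := hx i.
have /andP[_] := bernoulli_shortfall_bounds N l hx.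
have := pois_shortfall_le_chord l_gt0 sN; have := sum_rank_le hl.
rewrite -/(r _) /r; set t := Num.min _ _; set F := \sum_(i in _) x i in sF *.
set L := \sum_S _; set W := \sum_S _; set h := pois_shortfall _ _.
set p := pois_pmf _ _ in p0 p1 *.
move=> h1 h2 h3; nra.
Qed.

End GapUniformPlusFree.

(** * Upper bound at a point supported on equal blocks *)

Section BlockExample.
Context {R : realType} (m l k : nat).
Context (m_gt0 : (0 < m)%N) (l_gt0 : (0 < l)%N).

Let E : finType := ('I_m * 'I_l + 'I_k)%type.

Definition block_part : {set E} :=
  [set e : E | if e is inl _ then true else false]%SET.

Let B (j : 'I_m) : {set E} :=
  [set e : E | if e is inl p then p.1 == j else false]%SET.

(* The uniform distribution lambda0 on the blocks B j has marginals x0, since the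
   blocks partition the uniform part; this avoids counting all l-subsets. *)
Let x0 (e : E) : R := if e is inl _ then m%:R^-1 else 0.

Let lambda0 (S : {set E}) : R := \sum_(j < m) (S == B j)%:R / m%:R.

Lemma card_block_part : #|block_part| = (m * l)%N.
Proof.
rewrite -[RHS](congr2 muln (card_ord m) (card_ord l)) -card_prod.
rewrite -(card_imset _ (@inl_inj ('I_m * 'I_l) 'I_k)); apply: eq_card => -[p|q].
  by rewrite !inE; apply/esym/imsetP; exists p.
by rewrite !inE; apply/esym/negP => /imsetP[].
Qed.

Lemma card_setC_block_part : #|(~: block_part)%SET| = k.
Proof.
have := cardsC block_part; rewrite card_block_part card_sum card_prod !card_ord.
by move/addnI.
Qed.

Let card_block j : #|B j| = l.
Proof.
rewrite -[RHS]card_ord.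
rewrite -(card_imset _ (f := fun i : 'I_l => inl (j, i) : E)); last first.
  by move=> i i' [].
apply: eq_card => -[[j' i]|q]; rewrite !inE /=.
  by apply/eqP/imsetP => [->|[i' _ []]//]; exists i.
by apply/esym/negP => /imsetP[].
Qed.

Let mR : m%:R != 0 :> R.
Proof. by rewrite pnatr_eq0 -lt0n. Qed.

Let lambda0_expect (g : {set E} -> R) :
  \sum_S lambda0 S * g S = \sum_(j < m) g (B j) / m%:R.
Proof.
under eq_bigr do rewrite mulr_suml.
rewrite exchange_big /=; apply: eq_bigr => j _.
rewrite (bigD1 (B j)) //= eqxx big1 ?addr0 => [|S /negbTE ->]; last first.
  by rewrite !mul0r.
by rewrite mul1r mulrC.
Qed.

Let lambda0_marginal : marginal_distr x0 lambda0.
Proof.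
have E1 : \sum_(j < m) (m%:R^-1 : R) = 1.
  by rewrite sumr_const card_ord -[LHS]mulr_natr mulVf.
split=> [e||S]; last by rewrite sumr_ge0// => j _; rewrite divr_ge0.
  rewrite big_mkcond (eq_bigr (fun S => lambda0 S * (e \in S)%:R)); last first.
    by move=> S _; case: (e \in S); rewrite ?mulr1 ?mulr0.
  rewrite lambda0_expect; case: e => [[j i]|q] /=; last first.
    by apply: big1 => j _; rewrite inE mul0r.
  rewrite (bigD1 j) //= inE eqxx big1 ?addr0 ?mul1r // => j' jj'.
  by rewrite inE /= eq_sym (negbTE jj') mul0r.
rewrite (eq_bigr (fun S => lambda0 S * 1)) => [|S _]; last by rewrite mulr1.
by rewrite lambda0_expect -[RHS]E1; apply: eq_bigr => j _; rewrite mul1r.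
Qed.

Let x0_cube : unit_cube x0.
Proof.
move=> [p|q] /=; last by rewrite lexx ler01.
by rewrite invr_ge0 ler0n invf_le1 ?ltr0n// ler1n.
Qed.

Lemma gap_block_le :
  matroid_correlation_gap R (uniform_plus_free block_part l)
    <= 1 - pois_pmf l l%:R + m%:R^-1.
Proof.
pose r S : R := (mrank (uniform_plus_free block_part l) S)%:R.
have Er : \sum_S lambda0 S * r S = l%:R.
  rewrite lambda0_expect (eq_bigr (fun=> l%:R / m%:R)) => [|j _].
    by rewrite sumr_const card_ord -[LHS]mulr_natr divfK.
  congr (_%:R / _); rewrite mrank_uniform_plus_free.
  have BN : B j \subset block_part.
    by apply/fintype.subsetP => -[p|q]; rewrite !inE.
  rewrite (finset.setIidPl BN) card_block minnn.
  have /eqP -> : (B j :\: block_part == finset.set0)%SET.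
    by rewrite finset.setD_eq0.
  by rewrite cards0 addn0.
have lR : 0 < l%:R :> R by rewrite ltr0n.
have s0 : 0 < \sum_S lambda0 S * r S by rewrite Er.
have := correlation_gap_le (fun S => ler0n R _) x0_cube lambda0_marginal s0.
rewrite Er => /le_trans; apply; rewrite ler_pdivrMr//.
rewrite multilinear_extE.
rewrite (sum_rank_shortfallE _ _ (bernoulli_weight_marginal x0_cube)).
rewrite [X in _ + X]big1 ?addr0; last by move=> [p|q]; rewrite !inE.
have /andP[+ _] := bernoulli_shortfall_bounds block_part l x0_cube.
have sumN (g : R) : \sum_(i in block_part) g = (m * l)%:R * g.
  by rewrite sumr_const card_block_part mulr_natl.
rewrite (eq_bigr (fun=> m%:R^-1)) => [|[p|q]]; rewrite ?inE//.
rewrite [X in _ - X <= _](eq_bigr (fun=> m%:R^-1 ^+ 2)) => [|[p|q]];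
  rewrite ?inE//.
rewrite !sumN natrM expr2.
rewrite (_ : m%:R * l%:R / m%:R = l%:R); last by field.
rewrite (_ : m%:R * l%:R * (m%:R^-1 * m%:R^-1) = l%:R * m%:R^-1); last by field.
rewrite pois_shortfallE subrr mul0r add0r.
set W := \sum_S _ => h; lra.
Qed.

End BlockExample.

Theorem mainTheorem7 (R : realType) (rho l : nat)
    (l_gt0 : (0 < l)%N) (l_le_rho : (l <= rho)%N)
    (eps : R) (eps_gt0 : 0 < eps) :
  exists (E : finType) (M : matroid E),
    [/\ matroid_rank M = rho,
        has_girth M l.+1
      & `| matroid_correlation_gap R M
           - (1 - expR (- l%:R) * l%:R ^+ l / l`!%:R) | <= eps].
Proof.
have [n] := ltr_add_invr eps_gt0; rewrite add0r => n_eps.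
(* One more than needed for the precision, so that m * l > l also when n = 0. *)
pose m := n.+2; have m_gt0 : (0 < m)%N by [].
exists ('I_m * 'I_l + 'I_(rho - l))%type.
exists (uniform_plus_free (block_part m l (rho - l)) l); split.
- rewrite /matroid_rank mrank_uniform_plus_free finset.setTI finset.setTD.
  rewrite card_block_part card_setC_block_part.
  by rewrite (minn_idPr _) ?subnKC// leq_pmull.
- by apply: has_girth_uniform_plus_free; rewrite card_block_part /m; nia.
rewrite -mulrA -/(pois_pmf l l%:R).
have lo := @gap_uniform_plus_free_ge R _ (block_part m l (rho - l)) _ l_gt0.
have hi := @gap_block_le R m l (rho - l) m_gt0 l_gt0.
have m_eps : m%:R^-1 <= eps.
  by apply: ltW (le_lt_trans _ n_eps); rewrite lef_pV2 ?posrE ?ltr0n// ler_nat.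
rewrite ger0_norm ?subr_ge0// lerBlDl.
by apply: le_trans hi _; rewrite lerD2l.
Qed.
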